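(* Let $a>0$, $\lambda\in\mathbb{R}$, let $(\gamma_i)_{i\ge0}$ be i.i.d. with law $GIG(\lambda,a,a)$, and for $n\ge1$ let $$\widetilde N_n^{(-\lambda)}=\sum_{k=0}^{n-1}\gamma_k^{-1}\Big(\prod_{j=k+1}^{n-1}\gamma_j^{-1}\Big)^2 .$$ The process $(\widetilde N_n^{(-\lambda)})_{n\ge1}$ is a homogeneous Markov chain starting from $\widetilde N_1^{(-\lambda)}=\gamma_0^{-1}$ with transition kernel given, for $x>0$, by $$\widetilde K(x,dy)=\frac{1}{2K_\lambda(a^2)\sqrt{1+4xy}}\left(\frac{-1+\sqrt{1+4xy}}{2x}\right)^{-\lambda-1}e^{-\frac{a^2}{2}\left(\frac{-1+\sqrt{1+4xy}}{2x}+\frac{2x}{-1+\sqrt{1+4xy}}\right)}\mathbf{1}_{(0,+\infty)}(y)\,dy.$$ Moreover, if $\lambda>0$, this Markov chain is reversible with invariant probability measure $$d\pi(x)=\frac{a^{2\lambda}}{2^\lambda\Gamma(\lambda)}x^{-\lambda-1}e^{-\frac{a^2}{2x}}\mathbf{1}_{(0,+\infty)}(x)\,dx,$$ which is an inverse-gamma distribution.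
   Context: Empty products equal $1$; $\Gamma$ is Euler's gamma function. For $a>0$ and $\lambda\in\mathbb{R}$, $GIG(\lambda,a,a)$ (Generalized Inverse Gaussian) is the probability law on $(0,+\infty)$ with density $x\mapsto \frac{1}{2K_\lambda(a^2)}x^{\lambda-1}e^{-\frac{a^2}{2}(x+\frac1x)}$, where $K_\lambda(z)=\frac12\int_0^{+\infty}x^{\lambda-1}e^{-\frac z2(x+\frac1x)}dx$ for $z>0$ is the Macdonald function. Reversible means $\pi(dx)\widetilde K(x,dy)=\pi(dy)\widetilde K(y,dx)$. *)

(* Defs.v *)
From HB Require Import structures.
From mathcomp Require Import all_boot all_order all_algebra.
From mathcomp Require Import finmap.
From mathcomp Require Import all_classical all_reals all_analysis.

Set Implicit Arguments.
Unset Strict Implicit.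
Unset Printing Implicit Defensive.

Import Order.TTheory GRing.Theory Num.Theory.
Import numFieldNormedType.Exports.

Local Open Scope classical_set_scope.
Local Open Scope ring_scope.

Section special_functions.
Context {R : realType}.
Implicit Types (a lambda x y z : R).

Definition Macdonald lambda z : R :=
  2^-1 * \int[lebesgue_measure]_(x in `]0, +oo[)
           (x `^ (lambda - 1) * expR (- (z / 2) * (x + x^-1))).

Definition Gamma z : R :=
  \int[lebesgue_measure]_(x in `]0, +oo[) (x `^ (z - 1) * expR (- x)).

Definition GIG_pdf lambda a x : R :=
  (2 * Macdonald lambda (a ^+ 2))^-1 * x `^ (lambda - 1) *
  expR (- (a ^+ 2 / 2) * (x + x^-1)) * \1_(`]0, +oo[) x.

Definition inverse_gamma_pdf shape scale x : R :=
  scale `^ shape / Gamma shape * x `^ (- shape - 1) * expR (- scale / x) *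
  \1_(`]0, +oo[) x.

Definition Ktilde_pdf lambda a x y : R :=
  (2 * Macdonald lambda (a ^+ 2) * Num.sqrt (1 + 4 * x * y))^-1 *
  ((- 1 + Num.sqrt (1 + 4 * x * y)) / (2 * x)) `^ (- lambda - 1) *
  expR (- (a ^+ 2 / 2) *
    ((- 1 + Num.sqrt (1 + 4 * x * y)) / (2 * x) +
     2 * x / (- 1 + Num.sqrt (1 + 4 * x * y)))) * \1_(`]0, +oo[) y.

Definition pi_pdf lambda a x : R :=
  a `^ (2 * lambda) / (2 `^ lambda * Gamma lambda) * x `^ (- lambda - 1) *
  expR (- (a ^+ 2) / (2 * x)) * \1_(`]0, +oo[) x.

Definition has_density (m : set R -> \bar R) (f : R -> R) : Prop :=
  forall B : set R, measurable B ->
    m B = (\int[lebesgue_measure]_(x in B) (f x)%:E)%E.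

End special_functions.

Section processes.
Context {d : measure_display} {T : measurableType d} {R : realType}.
Variable P : probability T R.

Definition mutually_independent (X : nat -> {RV P >-> R}) : Prop :=
  forall (J : {fset nat}) (B : nat -> set R),
    (forall i, measurable (B i)) ->
    P (\bigcap_(i in [set` J]) (X i @^-1` B i)) =
    (\prod_(i <- J) P (X i @^-1` B i))%E.

(* The sigma-algebra generated by [X 0, ..., X n]. *)
Definition past (X : nat -> T -> R) (n : nat) : set (set T) :=
  <<s \bigcup_(i in `I_n.+1) preimage_set_system setT (X i) measurable >>.

(* Since [R] is the ambient space, the values of [K] outside the state space
   [S] are irrelevant.  The last conjunct says that [K (X n) B] is a version of
   the conditional probability of [X n.+1 \in B] given [past X n]. *)
Definition homogeneous_markov_chain (S : set R) (X : nat -> T -> R)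
    (K : R.-pker R ~> R) : Prop :=
  [/\ forall n, measurable_fun setT (X n),
      forall n, P (X n @^-1` S) = 1%E,
      forall x, S x -> K x S = 1%E &
      forall n (A : set T) (B : set R), past X n A -> measurable B ->
        P (A `&` X n.+1 @^-1` B) = (\int[P]_(w in A) K (X n w) B)%E].

Definition Ntilde (gamma : nat -> T -> R) (n : nat) (w : T) : R :=
  \sum_(0 <= k < n)
    (gamma k w)^-1 * (\prod_(k.+1 <= j < n) (gamma j w)^-1) ^+ 2.

End processes.

Section kernels.
Context {R : realType}.
Variables (pi : probability R R) (K : R.-pker R ~> R).

(* [pi(dx) K(x, dy) = pi(dy) K(y, dx)], as measures on [R * R]. *)
Definition reversible_wrt : Prop :=
  forall C : set (R * R), measurable C ->
    (\int[pi]_x K x (xsection C x) = \int[pi]_y K y (ysection C y))%E.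

Definition invariant_measure : Prop :=
  forall B : set R, measurable B -> (\int[pi]_x K x B = pi B)%E.

End kernels.

(* Main.v *)
(* With [u = 1 / gamma_n] one has [N_(n+1) = N_n * u ^ 2 + u], and [gamma_n] is
   independent of [N_1, ..., N_n]; so [N] is a Markov chain whose kernel [K x]
   is the image of the law of [gamma] under [g |-> x / g ^ 2 + 1 / g].  This map
   is a decreasing bijection of the positive half-line whose inverse solves a
   quadratic equation; changing variables gives the density of [K x].
   Reversibility is the pointwise identity [p x * k x y = p y * k y x] between
   densities: with [D = sqrt (1 + 4 x y)] and [u] the positive root of
   [x u ^ 2 + u = y], the quantities [x * u = (D - 1) / 2] and
   [1 / x + u + 1 / u = (D + 1) / 2 * (1 / x + 1 / y)] are symmetric. *)
Require Import Defs.
From HB Require Import structures.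
From mathcomp Require Import all_boot all_order all_algebra.
From mathcomp Require Import finmap.
From mathcomp Require Import all_classical all_reals all_analysis.
From mathcomp Require Import measurable_realfun ring lra.

Set Implicit Arguments.
Unset Strict Implicit.
Unset Printing Implicit Defensive.

Import Order.TTheory GRing.Theory Num.Theory.
Import numFieldNormedType.Exports.

Local Open Scope classical_set_scope.
Local Open Scope ring_scope.

(** Three gaps separate this plan from a proof. Independence is given for finite families of events,
    whereas the Markov property needs it for a whole sigma-algebra; a pi-system of cylinders bridges
    the two. Substitution is a statement about integrals over compact intervals, whereas densities
    are tested on all Borel sets; agreement on [[a, b]] with [0 < a] is extended by uniqueness of
    measures, the non-positive reals being null. That result serves twice, for
    [g |-> x / g ^ 2 + 1 / g] and for [x |-> s / x]; the latter identifies the mass of the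
    inverse-gamma weight with [Gamma lambda]. Since [Gamma] is the finite part of an extended
    integral, this mass must first be shown finite and positive. The kernel is a total map on the
    reals, with [0^-1 = 0], and its density is known at positive points only. *)

Lemma measurable_inv (R : realType) :
  measurable_fun [set: R] (fun x : R => x^-1).
Proof.
rewrite (_ : [set: R] = [set 0] `|` ~` [set 0]); last by rewrite setUv.
apply/measurable_funU => //; first exact: measurableC.
split; first exact: measurable_fun_set1.
apply: open_continuous_measurable_fun; first exact: closed_openC.
by move=> x; rewrite inE/= => /eqP x0; exact: inv_continuous.
Qed.

(** * Measures given by densities, and image measures *)

Section integral_density.
Context d (T : measurableType d) (R : realType).
Variables (mu m : {measure set T -> \bar R}) (f : T -> R).
Hypotheses (f0 : forall x, 0 <= f x) (mf : measurable_fun setT f).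
Hypothesis mE : forall B, measurable B -> m B = (\int[mu]_(x in B) (f x)%:E)%E.

Import HBNNSimple.

(** By monotone convergence along simple functions increasing to [g], and then by linearity, the
    claim reduces to indicators, where it is [mE]. *)
Lemma ge0_integral_density (g : T -> \bar R) : (forall x, (0 <= g x)%E) ->
  measurable_fun setT g ->
  (\int[m]_x g x = \int[mu]_x (g x * (f x)%:E))%E.
Proof.
move=> g0 mg; pose h := nnsfun_approx measurableT mg.
have gE x : g x = limn (EFin \o h ^~ x).
  by apply/esym/cvg_lim => //; exact: cvg_nnsfun_approx.
have mind r n : measurable_fun setT
    (fun x => ((r * \1_(h n @^-1` [set r]) x) * f x)%:E).
  by apply/measurable_EFinP; apply: measurable_funM => //;
    exact: measurable_funM.
transitivity (limn (fun n => \int[m]_x (h n x)%:E)%E).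
  rewrite -monotone_convergence//.
  - by apply: eq_integral => x _; rewrite gE.
  - by move=> n; exact/measurable_EFinP.
  - by move=> n x _; rewrite lee_fin.
  - by move=> x _ a b ab; rewrite lee_fin; exact/lefP/nd_nnsfun_approx.
transitivity (limn (fun n => \int[mu]_x ((h n x)%:E * (f x)%:E))%E); last first.
  rewrite -monotone_convergence//.
  - apply: eq_integral => x _; apply/cvg_lim => //.
    by apply: cvgeZr => //; exact: cvg_nnsfun_approx.
  - by move=> n; apply/emeasurable_funM; exact/measurable_EFinP.
  - by move=> n x _; rewrite -EFinM lee_fin mulr_ge0.
  - move=> x _ a b ab; rewrite lee_wpmul2r// lee_fin//.
    exact/lefP/nd_nnsfun_approx.
apply/congr_lim/funext => n.
transitivity (\sum_(r \in range (h n))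
    \int[mu]_x ((r * \1_(h n @^-1` [set r]) x) * f x)%:E)%E; last first.
  rewrite -ge0_integral_fsum//.
  - apply: eq_integral => x _; rewrite fsumEFin// -mulr_fsuml fimfunE.
    by rewrite EFinM.
  - move=> r x _; rewrite lee_fin mulr_ge0//.
    by have := nnfun_muleindic_ge0 (h n) r x; rewrite lee_fin.
transitivity (\int[m]_x (\sum_(r \in range (h n))
    (r * \1_(h n @^-1` [set r]) x)%:E))%E.
  by apply: eq_integral => x _; rewrite fsumEFin// -fimfunE.
rewrite ge0_integral_fsum//; last 2 first.
  - by move=> r; apply/measurable_EFinP; exact: measurable_funM.
  - by move=> r x _; exact: nnfun_muleindic_ge0.
apply: eq_fsbigr => r /set_mem[t _ <-].
rewrite integralZl_indic_nnsfun// integral_indic// setIT.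
under [RHS]eq_integral do rewrite -mulrA EFinM.
rewrite ge0_integralZl//.
- rewrite mE//; congr (_ * _)%E; rewrite integral_mkcond.
  apply: eq_integral => x _; rewrite patchE indicE.
  by case: ifPn => _; rewrite ?mul1r ?mul0r.
- by apply/measurable_EFinP; exact: measurable_funM.
- by move=> x _; rewrite lee_fin mulr_ge0.
- by rewrite lee_fin.
Qed.

End integral_density.

(** The measurability proof is an argument so that the measure structures below can be inferred from
    the term alone; [density_measure] carries its hypotheses for the same reason. *)
Definition image_measure d d' (T : measurableType d) (T' : measurableType d')
    (R : realType) (mu : set T -> \bar R) (f : T -> T')
    of measurable_fun setT f :=
  pushforward mu f.

Section image_measure.
Context d d' (T : measurableType d) (T' : measurableType d') (R : realType).
Variables (mu : {measure set T -> \bar R}) (f : T -> T').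
Hypothesis mf : measurable_fun setT f.

Let image_measure0 : image_measure mu mf set0 = 0%E.
Proof. exact: measure0. Qed.

Let image_measure_ge0 A : (0 <= image_measure mu mf A)%E.
Proof. exact: measure_ge0. Qed.

Let image_measure_sigma_additive : semi_sigma_additive (image_measure mu mf).
Proof. exact: measure_semi_sigma_additive. Qed.

HB.instance Definition _ := isMeasure.Build _ _ _ (image_measure mu mf)
  image_measure0 image_measure_ge0 image_measure_sigma_additive.

End image_measure.

Section finite_image_measure.
Context d d' (T : measurableType d) (T' : measurableType d') (R : realType).
Variables (mu : {finite_measure set T -> \bar R}) (f : T -> T').
Hypothesis mf : measurable_fun setT f.

Let image_measure_fin : fin_num_fun (image_measure mu mf).
Proof.
move=> A mA; apply: fin_num_measure.
by rewrite -[X in measurable X]setTI; exact: mf.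
Qed.

HB.instance Definition _ :=
  Measure_isFinite.Build _ _ _ (image_measure mu mf) image_measure_fin.

End finite_image_measure.

Definition density_measure d (T : measurableType d) (R : realType)
    (mu : {measure set T -> \bar R}) (f : T -> R)
    of (forall x, 0 <= f x) & measurable_fun setT f :=
  fun B => (\int[mu]_(x in B) (f x)%:E)%E.

Section density_measure.
Context d (T : measurableType d) (R : realType).
Variables (mu : {measure set T -> \bar R}) (f : T -> R).
Hypotheses (f0 : forall x, 0 <= f x) (mf : measurable_fun setT f).

Let density0 : density_measure mu f0 mf set0 = 0%E.
Proof. exact: integral_set0. Qed.

Let density_ge0 B : (0 <= density_measure mu f0 mf B)%E.
Proof. by apply: integral_ge0 => x _; rewrite lee_fin. Qed.

Let density_sigma_additive : semi_sigma_additive (density_measure mu f0 mf).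
Proof.
move=> F mF tF mUF; rewrite /density_measure ge0_integral_bigcup//;
  last 2 first.
- by apply/measurable_EFinP; exact: measurable_funTS.
- by move=> x _; rewrite lee_fin.
by apply: is_cvg_ereal_nneg_natsum => n _; apply: integral_ge0 => x _;
  rewrite lee_fin.
Qed.

HB.instance Definition _ := isMeasure.Build _ _ _ (density_measure mu f0 mf)
  density0 density_ge0 density_sigma_additive.

End density_measure.

Section has_density.
Context (R : realType).

(* The integrals in [has_density] are over [measurableTypeR R], whose
   measurable structure is the one of [R] up to the display. *)
Let toR : measurableTypeR R -> R := idfun.
Let ofR : R -> measurableTypeR R := idfun.

Let measurable_toR : measurable_fun setT toR.
Proof. by move=> _ B mB; rewrite setTI. Qed.

Let measurable_ofR : measurable_fun setT ofR.
Proof. by move=> _ B mB; rewrite setTI. Qed.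

Lemma ge0_integral_has_density (m : {measure set R -> \bar R}) (f : R -> R)
    (g : R -> \bar R) : (forall x, 0 <= f x) -> measurable_fun setT f ->
  has_density m f -> (forall x, (0 <= g x)%E) -> measurable_fun setT g ->
  (\int[m]_x g x = \int[lebesgue_measure]_x (g x * (f x)%:E))%E.
Proof.
move=> f0 mf mE g0 mg.
rewrite -(@ge0_integral_density _ _ _ _ (image_measure m measurable_ofR))//.
by rewrite /image_measure (ge0_integral_pushforward measurable_ofR).
Qed.

Lemma exists_measure_has_density (f : R -> R) :
  (forall x, 0 <= f x) -> measurable_fun setT f ->
  exists m : {measure set R -> \bar R}, has_density m f.
Proof.
move=> f0 mf.
have mf' : @measurable_fun _ _ (measurableTypeR R) R setT f by [].
by exists (image_measure (density_measure lebesgue_measure f0 mf')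
  measurable_toR).
Qed.

Lemma exists_probability_has_density (f : R -> R) :
  (forall x, 0 <= f x) -> measurable_fun setT f ->
  (\int[lebesgue_measure]_x (f x)%:E = 1)%E ->
  exists m : probability R R, has_density m f.
Proof.
move=> f0 mf f1; have [m mE] := exists_measure_has_density f0 mf.
have mT : m setT = 1%E by rewrite mE.
(* Normalisation equips [m] with the structure of a probability. As its mass is 1, nothing is
   rescaled and the fallback [dirac 0] is never reached. *)
exists (mnormalize m (dirac (0 : R))) => B mB.
by rewrite /= /mnormalize mT onee_eq0/= invr1 mule1 mE.
Qed.

End has_density.

(** * Kernels driven by an independent variable *)

Section independent_transition.
Context d d1 d2 (T : measurableType d) (T1 : measurableType d1)
  (T2 : measurableType d2) (R : realType).
Variables (P : probability T R) (nu : probability T2 R).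
Variables (A : set T) (X : T -> T1) (Y : T -> T2).
Hypotheses (mA : measurable A) (mX : measurable_fun setT X)
  (mY : measurable_fun setT Y).
Hypothesis indep : forall B1 B2, measurable B1 -> measurable B2 ->
  P (A `&` X @^-1` B1 `&` Y @^-1` B2) = (P (A `&` X @^-1` B1) * nu B2)%E.

(** Under [P] restricted to [A], [indep] says that the law of [(X, Y)] is a product on rectangles,
    so it is the product measure everywhere, and that measure integrates sections. The restriction
    turns the conditioning event into part of the measure. *)
Lemma independent_transition (C : set (T1 * T2)) : measurable C ->
  P (A `&` [set w | C (X w, Y w)]) =
  (\int[P]_(w in A) nu (xsection C (X w)))%E.
Proof.
move=> mC; pose XY w := (X w, Y w).
have mXY : measurable_fun setT XY by exact: measurable_fun_pair.
pose PA := mrestr P mA.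
pose m1 := image_measure PA mX.
have m1E B : measurable B -> m1 B = P (A `&` X @^-1` B).
  by move=> mB; rewrite /m1 /image_measure /pushforward /PA/= /mrestr setIC.
have mu_eq B1 B2 : measurable B1 -> measurable B2 ->
    image_measure PA mXY (B1 `*` B2) = (m1 B1 * nu B2)%E.
  move=> mB1 mB2; rewrite m1E// -indep// /image_measure /pushforward /mrestr.
  by congr (P _); apply/seteqP; split => w /=; tauto.
have mnu := measurable_fun_xsection nu mC.
have mnuX : measurable_fun setT (fun w => nu (xsection C (X w))).
  exact: (measurableT_comp mnu).
transitivity (image_measure PA mXY C).
  by rewrite /image_measure /pushforward /mrestr setIC.
rewrite -(product_measure_unique mu_eq)// /product_measure1.
rewrite ge0_integral_pushforward//= preimage_setT.
(* The restriction of [P] to [A] has density [\1_A] with respect to [P]. *)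
rewrite (@ge0_integral_density _ _ _ P _ \1_A)//=.
- rewrite [RHS]integral_mkcond; apply: eq_integral => w _.
  by rewrite patchE indicE; case: ifPn => _; rewrite ?mule1 ?mule0.
- by move=> B mB; rewrite /mrestr integral_indic// setIC.
Qed.

End independent_transition.

Section random_map_kernel.
Context d1 d2 d3 (T1 : measurableType d1) (T2 : measurableType d2)
  (T3 : measurableType d3) (R : realType).
Variables (nu : probability T2 R) (phi : T1 * T2 -> T3).
Hypothesis mphi : measurable_fun setT phi.

Definition random_map_kernel (x : T1) : {measure set T3 -> \bar R} :=
  image_measure nu (measurable_fun_pair2 x mphi).

Lemma random_map_kernelE x B :
  random_map_kernel x B = nu (xsection (phi @^-1` B) x).
Proof.
rewrite /random_map_kernel/= /image_measure /pushforward; congr (nu _).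
by apply/seteqP; split => y; rewrite /xsection/= inE.
Qed.

Let random_map_kernel_measurable U : measurable U ->
  measurable_fun setT (random_map_kernel ^~ U).
Proof.
move=> mU; under eq_fun do rewrite random_map_kernelE.
apply: measurable_fun_xsection.
by rewrite -[X in measurable X]setTI; exact: mphi.
Qed.

HB.instance Definition _ := isKernel.Build _ _ _ _ _ random_map_kernel
  random_map_kernel_measurable.

Let random_map_kernel_prob x : random_map_kernel x setT = 1%E.
Proof. exact: probability_setT. Qed.

HB.instance Definition _ := Kernel_isProbability.Build _ _ _ _ _
  random_map_kernel random_map_kernel_prob.

Definition random_map_pker : R.-pker T1 ~> T3 := random_map_kernel.

End random_map_kernel.

(** * The recursion, independence from the past, and the Markov property *)

Section recursion.
Context d (T : measurableType d) (R : realType).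
Implicit Types gamma : nat -> T -> R.

Lemma Ntilde0 gamma w : Ntilde gamma 0 w = 0.
Proof. by rewrite /Ntilde big_geq. Qed.

Lemma NtildeS gamma n w : Ntilde gamma n.+1 w =
  Ntilde gamma n w * (gamma n w)^-1 ^+ 2 + (gamma n w)^-1.
Proof.
(* The new term [k = n] has an empty product; every older term gains the factor
   [(gamma n w)^-1 ^+ 2]. *)
rewrite /Ntilde big_nat_recr//= [in X in _ + X]big_geq// expr1n mulr1.
congr (_ + _); rewrite mulr_suml; apply: eq_big_nat => k /andP[_ kn].
by rewrite big_nat_recr//= exprMn mulrA.
Qed.

(** Only the first [n] variables are assumed measurable, so that the lemma also applies when [T]
    carries the sigma-algebra generated by finitely many of them. *)
Lemma Ntilde_measurable gamma n :
  (forall i, (i < n)%N -> measurable_fun setT (gamma i)) ->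
  measurable_fun setT (Ntilde gamma n).
Proof.
elim: n => [|n ih] mgamma.
  by rewrite (_ : Ntilde _ _ = cst 0)//; apply/funext => w; rewrite Ntilde0.
rewrite (_ : Ntilde _ _ = fun w =>
    Ntilde gamma n w * (gamma n w)^-1 ^+ 2 + (gamma n w)^-1); last first.
  by apply/funext => w; rewrite NtildeS.
have mV : measurable_fun setT (fun w => (gamma n w)^-1).
  by apply: measurableT_comp (@measurable_inv R) _; exact: mgamma.
apply: measurable_funD => //; apply: measurable_funM.
  by apply: ih => i /leqW; exact: mgamma.
exact: measurable_funX.
Qed.

Lemma Ntilde_gt0 gamma n w :
  (forall i, 0 < gamma i w) -> 0 < Ntilde gamma n.+1 w.
Proof.
move=> g0; elim: n => [|n ih]; rewrite NtildeS.
  by rewrite Ntilde0 mul0r add0r invr_gt0.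
by rewrite addr_gt0// ?invr_gt0// mulr_gt0// exprn_gt0// invr_gt0.
Qed.

End recursion.

Section past.
Context d (T : measurableType d) (R : realType).
Implicit Types X Y : nat -> T -> R.

Lemma past_measurable X n : (forall i, measurable_fun setT (X i)) ->
  past X n `<=` measurable.
Proof.
move=> mX; apply: smallest_sub; first exact: sigma_algebra_measurable.
by move=> _ [i _] [B mB <-]; exact: mX.
Qed.

Lemma past_preimage X n i B : (i <= n)%N -> measurable B ->
  past X n (X i @^-1` B).
Proof.
move=> ij mB; apply: sub_sigma_algebra; exists i => //=.
by exists B => //; rewrite setTI.
Qed.

Lemma past_setI X n : setI_closed (past X n).
Proof.
pose G := \bigcup_(i in `I_n.+1) preimage_set_system setT (X i) measurable.
exact: (@measurableI _ (g_sigma_algebraType G)).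
Qed.

(** [Ntilde gamma i.+1] depends on [gamma 0] to [gamma i] only. Re-equipping [T] with the
    sigma-algebra [past gamma n] makes it a measurable function of that space. *)
Lemma past_Ntilde (gamma : nat -> T -> R) n :
  past (fun m => Ntilde gamma m.+1) n `<=` past gamma n.
Proof.
apply: smallest_sub; first exact: smallest_sigma_algebra.
move=> _ [i /= i_n] [B mB <-].
pose G := \bigcup_(i in `I_n.+1) preimage_set_system setT (gamma i) measurable.
have mgamma j : (j < i.+1)%N ->
    @measurable_fun _ _ (g_sigma_algebraType G) R setT (gamma j).
  move=> ji _ C mC; rewrite setTI; apply: past_preimage => //.
  by rewrite -ltnS (leq_trans ji).
exact: (@Ntilde_measurable _ (g_sigma_algebraType G) R gamma i.+1 mgamma).
Qed.

End past.

Section past_independence.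
Context d (T : measurableType d) (R : realType) (P : probability T R).
Variable gamma : nat -> {RV P >-> R}.
Hypothesis gamma_indep : mutually_independent gamma.

(** A pi-system generating [past gamma n], on which mutual independence can be applied directly. *)
Let cylinder n := [set A | exists2 F : nat -> set R,
  (forall i, measurable (F i)) & A = \bigcap_(i in `I_n.+1) (gamma i @^-1` F
    i)].

Let cylinderT n : cylinder n setT.
Proof.
exists (fun=> setT) => //.
by apply/seteqP; split => // w _ i _; rewrite preimage_setT.
Qed.

Let cylinderI n : setI_closed (cylinder n).
Proof.
move=> _ _ [F mF ->] [F' mF' ->]; exists (fun i => F i `&` F' i).
  by move=> i; exact: measurableI.
by rewrite -bigcapI; apply: eq_bigcapr => i _; rewrite preimage_setI.
Qed.

Let cylinder_measurable n : cylinder n `<=` measurable.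
Proof.
move=> _ [F mF ->]; apply: bigcap_measurable; first by exists 0%N.
by move=> i _; rewrite -[X in measurable X]setTI; exact: measurable_funPT.
Qed.

Let past_cylinder n : past gamma n `<=` <<s cylinder n >>.
Proof.
apply: sub_sigma_algebra2 => _ [i /= ni] [B mB <-].
exists (fun j => if j == i then B else setT).
  by move=> j; case: ifP.
rewrite setTI; apply/seteqP; split => w /= wB.
  by move=> j _ /=; case: eqP => // ->.
by have := wB i ni; rewrite /= eqxx.
Qed.

(** Mutual independence is used for [J], the indices up to [n], and for [J] with [n.+1] added; the
    two products differ by the factor of [gamma n.+1]. *)
Let cylinder_indep n A B : cylinder n A -> measurable B ->
  P (A `&` gamma n.+1 @^-1` B) = (P A * P (gamma n.+1 @^-1` B))%E.
Proof.
move=> [F mF ->] mB.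
pose J : {fset nat} := [fset i in iota 0 n.+1]%fset.
have JE i : (i \in J) = (i < n.+1)%N by rewrite in_fset mem_iota.
pose F' i := if i == n.+1 then B else F i.
have mF' i : measurable (F' i) by rewrite /F'; case: ifP.
have nJ : n.+1 \notin J by rewrite JE ltnn.
have F'J i : i \in J -> F' i = F i.
  by rewrite JE /F' => iJ; rewrite ltn_eqF.
have -> : \bigcap_(i in `I_n.+1) (gamma i @^-1` F i) =
    \bigcap_(i in [set` J]) (gamma i @^-1` F i).
  by apply: eq_bigcapl; split => i /=; rewrite JE.
rewrite gamma_indep//.
have -> : \bigcap_(i in [set` J]) (gamma i @^-1` F i) `&` gamma n.+1 @^-1` B =
    \bigcap_(i in [set` (n.+1 |` J)%fset]) (gamma i @^-1` F' i).
  apply/seteqP; split => w /=.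
    move=> [wJ wB] i /=; rewrite in_fset1U => /predU1P[->|iJ].
      by rewrite /F' eqxx.
    by rewrite F'J//; exact: wJ.
  move=> wJ; split; last first.
    by have := wJ n.+1; rewrite /= in_fset1U eqxx/= /F' eqxx; exact.
  move=> i /= iJ; rewrite -F'J//; apply: wJ => /=.
  by rewrite in_fset1U iJ orbT.
rewrite gamma_indep// big_fsetU1//= [RHS]muleC; congr (_ * _)%E.
  by rewrite /F' eqxx.
by rewrite !big_seq; apply: eq_bigr => i iJ; rewrite F'J.
Qed.

(** For fixed [B] both sides are finite measures in [A]: [P] restricted to [E], and [P] scaled by
    [P E]. Agreeing on cylinders, they agree on the generated sigma-algebra. *)
Lemma past_indep n A B : past gamma n A -> measurable B ->
  P (A `&` gamma n.+1 @^-1` B) = (P A * P (gamma n.+1 @^-1` B))%E.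
Proof.
move=> pA mB; set E := gamma n.+1 @^-1` B.
have mE : measurable E.
  by rewrite -[X in measurable X]setTI; exact: measurable_funPT.
have PE_ge0 : 0 <= fine (P E) by exact: fine_ge0.
transitivity (mscale (NngNum PE_ge0) P A); last first.
  by rewrite /mscale/= fineK ?fin_num_measure// muleC.
transitivity (mrestr P mE A); first by [].
apply: (@g_sigma_algebra_measure_unique _ _ _ (cylinder n) _ (fun=> setT)).
- exact: cylinder_measurable.
- by [].
- by rewrite bigcup_const.
- exact: cylinderI.
- move=> C cC; rewrite /=/mrestr /E cylinder_indep//.
  by rewrite /mscale/= fineK ?fin_num_measure// muleC.
- by move=> _; rewrite /= /mrestr setTI (le_lt_trans (probability_le1 _ _))
    ?ltry.
- exact: past_cylinder.
Qed.

End past_independence.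

Section markov.
Context (R : realType).

Definition step (p : R * R) : R := p.1 * p.2^-1 ^+ 2 + p.2^-1.

Lemma measurable_step : measurable_fun setT step.
Proof.
have mV : measurable_fun setT (fun p : R * R => p.2^-1).
  exact: measurableT_comp (@measurable_inv R) _.
by apply: measurable_funD => //; apply: measurable_funM => //;
  exact: measurable_funX.
Qed.

Context d (T : measurableType d) (P : probability T R).
Variables (gamma : nat -> {RV P >-> R}) (nu : probability R R).
Hypothesis gamma_indep : mutually_independent gamma.
Hypothesis gamma_law : forall i B, measurable B -> P (gamma i @^-1` B) = nu B.
Hypothesis nu_gt0 : nu `]0, +oo[%classic = 1%E.

Let mNtilde n : measurable_fun setT (Ntilde gamma n).
Proof. by apply: Ntilde_measurable => i _; exact: measurable_funPT. Qed.

Let measurable_preim (f : T -> R) B : measurable_fun setT f ->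
  measurable B -> measurable (f @^-1` B).
Proof. by move=> mf mB; rewrite -[X in measurable X]setTI; exact: mf. Qed.

(** The variables [gamma i] are positive only almost surely; the pointwise bound [Ntilde_gt0] holds
    off a countable union of null sets. *)
Let Ntilde_gt0_ae n : P (Ntilde gamma n.+1 @^-1` `]0, +oo[) = 1%E.
Proof.
set N := _ @^-1` _.
have mN : measurable N by exact: measurable_preim.
have mpos i : measurable (gamma i @^-1` `]0, +oo[).
  by apply: measurable_preim => //; exact: measurable_funPT.
suff : P (~` N) = 0%E.
  by move=> PN; rewrite -(setCK N) probability_setC ?PN ?sube0//;
    exact: measurableC.
apply: measure_negligible; first exact: measurableC.
apply: (@negligibleS _ _ _ _ (\bigcup_i ~` (gamma i @^-1` `]0, +oo[))).
  rewrite -setC_bigcap; apply: subsetC => w wpos.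
  rewrite /N/= in_itv/= andbT; apply: Ntilde_gt0 => i.
  by have := wpos i I; rewrite /= in_itv/= andbT.
apply: negligible_bigcup => i; apply/negligibleP; first exact: measurableC.
by have := probability_setC P (mpos i); rewrite gamma_law// nu_gt0 subee.
Qed.

Definition Ktilde : R.-pker R ~> R := random_map_pker nu measurable_step.

Lemma KtildeE x B : Ktilde x B = nu (xsection (step @^-1` B) x).
Proof. exact: random_map_kernelE. Qed.

Lemma Ntilde_markov :
  homogeneous_markov_chain P `]0, +oo[ (fun m => Ntilde gamma m.+1) Ktilde.
Proof.
split; [exact|exact| |].
- move=> x xS; have x0 : 0 < x by move: xS; rewrite /= in_itv/= andbT.
  have mS : measurable (xsection (step @^-1` `]0, +oo[) x).
    apply: measurable_xsection; rewrite -[X in measurable X]setTI.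
    exact: measurable_step.
  rewrite KtildeE; apply/eqP.
  rewrite eq_le probability_le1//= -[leLHS]nu_gt0 le_measure ?inE//.
  move=> y; rewrite /= in_itv/= andbT => y0; rewrite /xsection/= inE/= in_itv/=.
  by rewrite andbT /step/= addr_gt0 ?invr_gt0// mulr_gt0// exprn_gt0// invr_gt0.
- move=> n A B pA mB.
  have pA' := past_Ntilde pA.
  have mC : measurable (step @^-1` B).
    by rewrite -[X in measurable X]setTI; exact: measurable_step.
  under eq_integral do rewrite KtildeE.
  (* The state at time [n] is [Ntilde gamma n.+1], built from [gamma 0] to [gamma n]; the fresh
     variable is therefore [gamma n.+1]. *)
  rewrite -(@independent_transition _ _ _ _ _ _ _ P nu _ _ (gamma n.+1))//.
  + by congr (P (_ `&` _)); apply/funext => w /=; rewrite NtildeS.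
  + by apply: past_measurable pA' => i; exact: measurable_funPT.
  + move=> B1 B2 mB1 mB2; rewrite (past_indep gamma_indep) ?gamma_law//.
    apply: past_setI => //; apply: past_Ntilde.
    exact: (past_preimage (X := fun m => Ntilde gamma m.+1)).
Qed.

End markov.

(** * Change of variables for densities on the positive half-line *)

Lemma measure_setD_null d (T : measurableType d) (R : realType)
    (m : {measure set T -> \bar R}) (A N : set T) :
  measurable A -> measurable N -> m N = 0%E -> m (A `\` N) = m A.
Proof.
move=> mA mN mN0; rewrite [RHS](measureDI m mA mN).
rewrite [X in _ = (_ + X)%E](_ : _ = 0%E) ?adde0//.
by apply: subset_measure0 mN0 => //; exact: measurableI.
Qed.

Section measure_unique_pos.
Context (R : realType).
Implicit Types m : {measure set R -> \bar R}.

(** Compact intervals increasing to the positive part of [[c, +oo[]; the bound [n.+1%:R^-1] keeps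
    them away from 0. They may be empty for small [n]. *)
Let exhaust (c : R) n := `[Num.max c n.+1%:R^-1, n.+1%:R]%classic.

Let exhaust_nd c : nondecreasing_seq (exhaust c).
Proof.
move=> k n kn; apply/subsetPset => x; rewrite /exhaust/= !in_itv/= !ge_max.
move=> /andP[/andP[-> kx] xk] /=; apply/andP; split.
  by rewrite (le_trans _ kx)// lef_pV2 ?posrE// ler_nat.
by rewrite (le_trans xk)// ler_nat.
Qed.

Let exhaust_bigcup c : \bigcup_n exhaust c n = `[c, +oo[ `&` `]0, +oo[.
Proof.
apply/seteqP; split => x.
  move=> [n _]; rewrite /exhaust/= !in_itv/= !andbT ge_max => /andP[/andP[->
    nx] _].
  by split => //; rewrite (lt_le_trans _ nx)// invr_gt0.
rewrite /= !in_itv/= !andbT => -[cx x0].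
pose n := maxn (Num.truncn x) (Num.truncn x^-1).
exists n => //; rewrite /exhaust/= in_itv/= ge_max cx/=; apply/andP; split.
  rewrite invf_ple ?posrE// ltW// (lt_le_trans (truncnS_gt _))//.
  by rewrite ler_nat ltnS leq_maxr.
by rewrite ltW// (lt_le_trans (truncnS_gt _))// ler_nat ltnS leq_maxl.
Qed.

Let measure_ray m c : m `]-oo, 0]%classic = 0%E ->
  m (exhaust c n) @[n --> \oo] --> m `[c, +oo[%classic.
Proof.
move=> m0; have -> : m `[c, +oo[%classic = m (\bigcup_n exhaust c n).
  rewrite exhaust_bigcup -(measure_setD_null _ _ m0)//; congr (m _).
  by rewrite setDE setCitvl.
apply: nondecreasing_cvg_mu; first by move=> n; exact: measurable_itv.
  by apply: bigcupT_measurable => n; exact: measurable_itv.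
exact: exhaust_nd.
Qed.

(** The rays [[c, +oo[] form a generating pi-system. As the non-positive reals are null, the mass of
    a ray is the limit of the masses of the intervals [exhaust c n]. *)
Lemma measure_unique_pos m1 m2 :
  (m1 setT < +oo)%E ->
  m1 `]-oo, 0]%classic = 0%E -> m2 `]-oo, 0]%classic = 0%E ->
  (forall a b : R, 0 < a -> a <= b ->
    m1 `[a, b]%classic = m2 `[a, b]%classic) ->
  forall B, measurable B -> m1 B = m2 B.
Proof.
move=> m1oo m10 m20 m12.
have m12' c n : m1 (exhaust c n) = m2 (exhaust c n).
  rewrite /exhaust; have [le|gt] := leP (Num.max c n.+1%:R^-1) n.+1%:R.
    by apply: m12 => //; rewrite lt_max invr_gt0 ltr0n orbT.
  by rewrite set_itv_ge ?measure0// bnd_simp -ltNge.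
apply: (@measure_unique _ _ _ (@RGenCInfty.G R) (fun n => `[- n%:R,
  +oo[%classic)).
- exact: RGenCInfty.measurableE.
- move=> _ _ [x ->] [y ->]; exists (Num.max x y).
  by apply/seteqP; split => z; rewrite /= !in_itv/= !andbT ge_max => /andP.
- by move=> n; exists (- n%:R).
- apply/seteqP; split => // x _; exists (Num.truncn `|x|).+1 => //=.
  rewrite in_itv/= andbT lerNl (le_trans _ (ltW (truncnS_gt _)))//.
  by rewrite -normrN ler_norm.
- move=> _ [c ->]; have := @measure_ray _ c m10.
  under eq_fun do rewrite m12'.
  by move=> /cvg_lim <- //; apply/cvg_lim => //; exact: measure_ray.
- move=> n; rewrite (le_lt_trans _ m1oo)// le_measure ?inE//.
Qed.

End measure_unique_pos.

Section substitution.
Context (R : realType).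
Notation mu := (@lebesgue_measure R).
Variables p q F F' H : R -> R.
Hypotheses (pN : forall x : R, x <= 0 -> p x = 0).
Hypotheses (q0 : forall x, 0 <= q x) (mq : measurable_fun setT q)
  (qN : forall x : R, x <= 0 -> q x = 0)
  (cq : forall x : R, 0 < x -> {for x, continuous q}).
Hypotheses (mF : measurable_fun setT F) (F0 : forall x : R, 0 < x -> 0 < F x)
  (Fdecr : forall x y : R, 0 < x -> x < y -> F y < F x)
  (dF : forall x : R, 0 < x -> is_derive x 1 F (F' x))
  (cF' : forall x : R, 0 < x -> {for x, continuous F'}).
Hypotheses (H0 : forall y : R, 0 < y -> 0 < H y)
  (FK : forall y : R, 0 < y -> F (H y) = y).
Hypothesis qFp : forall x : R, 0 < x -> q (F x) * - F' x = p x.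

Let substitution_itv (a b : R) : 0 < a -> a <= b ->
  (\int[mu]_(y in `[F b, F a]) (q y)%:E = \int[mu]_(x in `[a, b]) (p x)%:E)%E.
Proof.
move=> a0 ab; have b0 : 0 < b by exact: lt_le_trans ab.
have dF1 (x : R) : 0 < x -> derive1 F x = F' x by move=> x0; have h := dF x0;
  rewrite derive1E derive_val.
(* [derive1 F] is known to equal [F'] at positive points only, hence on a neighbourhood of each of
   them, which suffices for continuity. *)
have cdF (x : R) : 0 < x -> {for x, continuous (derive1 F)}.
  move=> x0; rewrite /prop_for /continuous_at dF1//; apply: cvg_trans (cF' x0).
  apply: near_eq_cvg; near=> z; rewrite dF1//; near: z; exact: lt_nbhsr.
have cF (x : R) : 0 < x -> {for x, continuous F}.
  move=> x0; apply: differentiable_continuous; apply/derivable1_diffP.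
  by have := dF x0; case.
rewrite integration_by_substitution_decreasing//.
- apply: eq_integral => x; rewrite inE/= in_itv/= => /andP[ax _].
  have x0 : 0 < x by exact: lt_le_trans ax.
  by rewrite -[in RHS]qFp// -dF1.
- move=> x y; rewrite !in_itv/= => /andP[ax _] /andP[ay _]  xy.
  by apply: Fdecr => //; exact: lt_le_trans ay.
- by move=> x; rewrite in_itv/= => /andP[ax _]; apply: cdF; exact: lt_trans ax.
- by apply/cvg_ex; exists ((derive1 F) a); apply: cvg_at_right_filter;
    exact: cdF.
- by apply/cvg_ex; exists (derive1 F b); apply: cvg_at_left_filter; exact: cdF.
- split.
  + move=> x; rewrite in_itv/= => /andP[ax _].
    by have := dF (lt_trans a0 ax); case.
  + by apply: cvg_at_right_filter; exact: cF.
  + by apply: cvg_at_left_filter; exact: cF.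
- apply: continuous_in_subspaceT => y; rewrite inE/= in_itv/= => /andP[Fy _].
  by apply: cq; apply: lt_le_trans Fy; exact: F0.
Unshelve. all: by end_near. Qed.

(** Nothing controls [F] on the non-positive reals, but [m] does not charge them. Up to that null
    set the preimage of [[a, b]] is [[H b, H a]], where substitution applies. *)
Lemma pushforward_decreasing_density (m : {finite_measure set R -> \bar R}) :
  has_density m p -> has_density (pushforward m F) q.
Proof.
move=> mE.
have mI0 : m `]-oo, 0]%classic = 0%E.
  rewrite mE// integral0_eq// => x; rewrite /= in_itv/= => x0.
  by rewrite pN.
move=> B mB.
have [mq' mqE] := exists_measure_has_density q0 mq; rewrite -mqE//.
have uniq := @measure_unique_pos R (image_measure m mF) mq'.
apply: (uniq _ _ _ _ B mB).
- rewrite -ge0_fin_numE//; exact: fin_num_measure.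
- apply/eqP; rewrite -measure_le0 -mI0 /=.
  apply: (le_measure m); rewrite ?inE//.
    by rewrite -[X in measurable X]setTI; exact: mF.
  move=> x; rewrite /= !in_itv/=; apply: contraTT; rewrite -!ltNge.
  exact: F0.
- rewrite mqE// integral0_eq// => x; rewrite /= in_itv/= => x0.
  by rewrite qN.
- move=> a b a0 ab; have b0 : 0 < b by exact: lt_le_trans ab.
  rewrite mqE// -{2}(FK a0) -{2}(FK b0).
  have Hab : H b <= H a.
    rewrite leNgt; apply/negP => /(Fdecr (H0 a0)).
    by rewrite !FK// ltNge ab.
  rewrite substitution_itv//; last exact: H0.
  rewrite -mE//; transitivity (m (F @^-1` `[a, b]%classic)); first by [].
  have mFab : measurable (F @^-1` `[a, b]).
    by rewrite -[X in measurable X]setTI; exact: mF.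
  rewrite -(measure_setD_null mFab _ mI0)//; congr (m _).
  apply/seteqP; split => x; rewrite /= !in_itv/=.
    move=> [/andP[aF Fb] /negP]; rewrite -ltNge => x0.
    apply/andP; split; rewrite leNgt; apply/negP.
      by move=> /(Fdecr x0); rewrite FK// ltNge Fb.
    by move=> /(Fdecr (H0 a0)); rewrite FK// ltNge aF.
  move=> /andP[bx xa]; have x0 : 0 < x by rewrite (lt_le_trans _ bx)// H0.
  split; last by apply/negP; rewrite -ltNge.
  rewrite -{1}(FK a0) -(FK b0); apply/andP; split.
    by move: xa; rewrite le_eqVlt => /predU1P[->//|/(Fdecr x0)/ltW].
  by move: bx; rewrite le_eqVlt => /predU1P[<-//|/(Fdecr (H0 b0))/ltW].
Qed.

End substitution.

(** * The quadratic equation and the density of the kernel *)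

Section quadratic.
Context (R : realType).
Implicit Types x y g : R.

Definition disc x y := Num.sqrt (1 + 4 * x * y).

(* The positive root [u] of [x * u ^ 2 + u = y]. *)
Definition qroot x y := (-1 + disc x y) / (2 * x).

Lemma discC x y : disc x y = disc y x.
Proof. by rewrite /disc mulrAC. Qed.

Lemma sqr_disc x y : 0 < x -> 0 < y -> disc x y ^+ 2 = 1 + 4 * x * y.
Proof. by move=> x0 y0; rewrite sqr_sqrtr// addr_ge0// !mulr_ge0// ltW. Qed.

Lemma disc_gt1 x y : 0 < x -> 0 < y -> 1 < disc x y.
Proof.
move=> x0 y0; rewrite -[ltLHS]sqrtr1 ltr_sqrt ?ltrDl ?mulr_gt0//.
by rewrite addr_gt0// !mulr_gt0.
Qed.

Lemma qroot_gt0 x y : 0 < x -> 0 < y -> 0 < qroot x y.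
Proof.
by move=> x0 y0; rewrite divr_gt0 ?mulr_gt0// addrC subr_gt0 disc_gt1.
Qed.

Lemma mul_qroot x y : 0 < x -> x * qroot x y = (disc x y - 1) / 2.
Proof. by move=> x0; rewrite /qroot; field; lra. Qed.

Lemma qrootK x y : 0 < x -> 0 < y -> x * qroot x y ^+ 2 + qroot x y = y.
Proof.
move=> x0 y0; have := sqr_disc x0 y0; rewrite /qroot; set D := disc x y => D2.
have -> : x * ((-1 + D) / (2 * x)) ^+ 2 + (-1 + D) / (2 * x) =
  (D ^+ 2 - 1) / (4 * x) by field; lra.
by rewrite D2; field; lra.
Qed.

Lemma disc_quadratic x u : 0 < x -> 0 < u ->
  disc x (x * u ^+ 2 + u) = 1 + 2 * x * u.
Proof.
move=> x0 u0; rewrite /disc.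
have -> : 1 + 4 * x * (x * u ^+ 2 + u) = (1 + 2 * x * u) ^+ 2 by ring.
by rewrite sqrtr_sqr ger0_norm// addr_ge0// !mulr_ge0// ltW.
Qed.

Lemma quadraticK x u : 0 < x -> 0 < u -> qroot x (x * u ^+ 2 + u) = u.
Proof.
by move=> x0 u0; rewrite /qroot disc_quadratic//; field; lra.
Qed.

(** Conjugate factors: the product with [qroot x y] is [(disc x y ^+ 2 - 1) / (4 * x * y)], which is
    1. This form exposes the symmetry needed for detailed balance. *)
Lemma qroot_inv x y : 0 < x -> 0 < y ->
  (qroot x y)^-1 = (disc x y + 1) / (2 * y).
Proof.
move=> x0 y0; have u0 := qroot_gt0 x0 y0.
have D1 := disc_gt1 x0 y0; have D2 := sqr_disc x0 y0.
apply: (mulfI (lt0r_neq0 u0)); rewrite divff ?lt0r_neq0// /qroot.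
have -> : (-1 + disc x y) / (2 * x) * ((disc x y + 1) / (2 * y)) =
  (disc x y ^+ 2 - 1) / (4 * x * y) by field; lra.
by rewrite D2; field; lra.
Qed.

Lemma measurable_disc : measurable_fun setT (fun p : R * R => disc p.1 p.2).
Proof.
apply: measurableT_comp.
  by apply: continuous_measurable_fun; exact: sqrt_continuous.
by apply: measurable_funD => //; apply: measurable_funM => //;
  exact: measurable_funM.
Qed.

Lemma measurable_qroot : measurable_fun setT (fun p : R * R => qroot p.1 p.2).
Proof.
apply: measurable_funM.
  by apply: measurable_funD => //; exact: measurable_disc.
by apply: measurableT_comp (@measurable_inv R) _; exact: measurable_funM.
Qed.

Lemma disc_continuous x : continuous (disc x).
Proof.
move=> y; apply: continuous_comp; last exact: sqrt_continuous.
apply: cvgD; first exact: cvg_cst.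
by apply: cvgM; [exact: cvg_cst|exact: cvg_id].
Qed.

Lemma qroot_continuous x : continuous (qroot x).
Proof.
move=> y; apply: cvgM; last exact: cvg_cst.
by apply: cvgD; [exact: cvg_cst|exact: disc_continuous].
Qed.

End quadratic.

Lemma is_derive_inv (R : realType) (x : R) : x != 0 ->
  is_derive x 1 (fun y : R => y^-1) (- x ^- 2).
Proof.
move=> x0; apply: DeriveDef; first exact: derivableV.
by rewrite deriveV// derive_id /GRing.scale/= mulr1.
Qed.

Lemma powR_continuous (R : realType) (p x : R) : 0 < x ->
  {for x, continuous (@powR R ^~ p)}.
Proof.
move=> x0; apply: differentiable_continuous; apply/derivable1_diffP.
by apply: derivable_powR; rewrite in_itv/= x0.
Qed.

Section densities.
Context (R : realType) (lambda a : R).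
Implicit Types x y g : R.

Lemma Macdonald_ge0 z : 0 <= Macdonald lambda z.
Proof.
rewrite mulr_ge0//; apply: Rintegral_ge0 => x _.
by rewrite mulr_ge0 ?powR_ge0 ?expR_ge0.
Qed.

Lemma indic_pos_gt0 x : 0 < x -> \1_(`]0, +oo[%classic) x = 1 :> R.
Proof. by move=> x0; rewrite indicE mem_set//= in_itv/= x0. Qed.

Lemma indic_pos_le0 x : x <= 0 -> \1_(`]0, +oo[%classic) x = 0 :> R.
Proof. by move=> x0; rewrite indicE memNset//= in_itv/= andbT; apply/negP;
  rewrite -leNgt. Qed.

Lemma GIG_pdf_ge0 x : 0 <= GIG_pdf lambda a x.
Proof.
by rewrite !mulr_ge0// ?powR_ge0 ?expR_ge0// invr_ge0 mulr_ge0// Macdonald_ge0.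
Qed.

Lemma GIG_pdf_le0 x : x <= 0 -> GIG_pdf lambda a x = 0.
Proof. by move=> x0; rewrite /GIG_pdf indic_pos_le0 ?mulr0. Qed.

Lemma measurable_GIG_pdf : measurable_fun setT (GIG_pdf lambda a).
Proof.
apply: measurable_funM => //; apply: measurable_funM.
  by apply: measurable_funM => //; exact: measurable_powR.
apply: measurableT_comp => //; apply: measurable_funM => //.
by apply: measurable_funD => //; exact: measurable_inv.
Qed.

Lemma Ktilde_pdfE x y : Ktilde_pdf lambda a x y =
  (2 * Macdonald lambda (a ^+ 2))^-1 * (disc x y)^-1 *
  qroot x y `^ (- lambda - 1) *
  expR (- (a ^+ 2 / 2) * (qroot x y + (qroot x y)^-1)) * \1_(`]0, +oo[) y.
Proof.
by rewrite /Ktilde_pdf [in LHS]invfM /qroot invf_div.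
Qed.

Lemma Ktilde_pdf_ge0 x y : 0 <= Ktilde_pdf lambda a x y.
Proof.
rewrite Ktilde_pdfE !mulr_ge0// ?powR_ge0 ?expR_ge0 ?invr_ge0//.
  by rewrite mulr_ge0// Macdonald_ge0.
exact: sqrtr_ge0.
Qed.

Lemma Ktilde_pdf_le0 x y : y <= 0 -> Ktilde_pdf lambda a x y = 0.
Proof. by move=> y0; rewrite /Ktilde_pdf indic_pos_le0 ?mulr0. Qed.

Lemma measurable_Ktilde_pdf :
  measurable_fun setT (fun p : R * R => Ktilde_pdf lambda a p.1 p.2).
Proof.
under eq_fun do rewrite Ktilde_pdfE.
apply: measurable_funM; last exact: measurableT_comp.
apply: measurable_funM.
  apply: measurable_funM.
    apply: measurable_funM => //.
    exact: measurableT_comp (@measurable_inv R) (@measurable_disc R).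
  exact: measurableT_comp (@measurable_powR R _) (@measurable_qroot R).
apply: measurableT_comp => //; apply: measurable_funM => //.
apply: measurable_funD; first exact: measurable_qroot.
exact: measurableT_comp (@measurable_inv R) (@measurable_qroot R).
Qed.

Lemma Ktilde_pdf_continuous x y : 0 < x -> 0 < y ->
  {for y, continuous (Ktilde_pdf lambda a x)}.
Proof.
move=> x0 y0.
(* The density without its indicator: it agrees with the density near [y], and each of its factors
   is continuous there. *)
pose k z := (2 * Macdonald lambda (a ^+ 2))^-1 * (disc x z)^-1 *
  qroot x z `^ (- lambda - 1) *
  expR (- (a ^+ 2 / 2) * (qroot x z + (qroot x z)^-1)).
have kE z : 0 < z -> k z = Ktilde_pdf lambda a x z.
  by move=> z0; rewrite Ktilde_pdfE indic_pos_gt0 ?mulr1.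
have cu := @qroot_continuous R x y; have u0 := qroot_gt0 x0 y0.
suff ck : k z @[z --> y] --> k y.
  rewrite /prop_for /continuous_at -kE//; apply: cvg_trans ck.
  by apply: near_eq_cvg; near=> z; rewrite kE//; near: z; exact: lt_nbhsr.
apply: cvgM; last first.
  apply: continuous_cvg; first exact: continuous_expR.
  apply: cvgM; first exact: cvg_cst.
  by apply: cvgD => //; apply: cvgV => //; exact: lt0r_neq0.
apply: cvgM; last first.
  by apply: (@continuous_cvg _ _ _ _ _ _ (@powR R ^~ _)) => //;
    exact: powR_continuous.
apply: cvgM; first exact: cvg_cst.
apply: cvgV; last exact: disc_continuous.
by rewrite lt0r_neq0// (lt_trans ltr01) ?disc_gt1.
Unshelve. all: by end_near. Qed.

Lemma Ktilde_has_density (nu : probability R R) x : 0 < x ->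
  has_density nu (GIG_pdf lambda a) ->
  has_density (Ktilde nu x) (Ktilde_pdf lambda a x).
Proof.
move=> x0 nuE.
pose F g := step (x, g).
pose F' g := - (2 * x * g^-1 ^+ 3 + g^-1 ^+ 2).
have mF : measurable_fun setT F by exact: measurable_fun_pair2
  (@measurable_step R).
have Finv g : F g = x * g^-1 ^+ 2 + g^-1 by [].
have Vgt0 (g : R) : 0 < g -> 0 < g^-1 by rewrite invr_gt0.
(* The inverse of [F] is the reciprocal of the root, since the quadratic equation is solved by
   [u = g^-1]. *)
apply: (@pushforward_decreasing_density R (GIG_pdf lambda a) _ F F'
  (fun y => (qroot x y)^-1)) => //.
- exact: GIG_pdf_le0.
- exact: Ktilde_pdf_ge0.
- exact: measurable_fun_pair2 measurable_Ktilde_pdf.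
- exact: Ktilde_pdf_le0.
- by move=> y; exact: Ktilde_pdf_continuous.
- by move=> g /Vgt0 g0; rewrite Finv addr_gt0// mulr_gt0// exprn_gt0.
- move=> g h g0 gh; have h0 := lt_trans g0 gh.
  have hg : h^-1 < g^-1 by rewrite ltf_pV2.
  by rewrite !Finv ltrD// ltr_pM2l// ltrXn2r ?ltW ?Vgt0.
- move=> g g0; rewrite /F /step /=.
  have := is_derive_inv (lt0r_neq0 g0); set V := (fun _ => _^-1) => dV.
  rewrite (_ : (fun _ => _) = cst x * V ^+ 2 + V)//.
  apply: is_derive_eq; rewrite /F' /V /GRing.scale/= mulr0 addr0.
  by field; exact: lt0r_neq0.
- move=> g g0; have cV : z^-1 @[z --> g] --> g^-1 by apply: inv_continuous;
    exact: lt0r_neq0.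
  have cVX n : z^-1 ^+ n @[z --> g] --> g^-1 ^+ n.
    exact: cvg_comp _ _ cV (@exprn_continuous R n _).
  apply: cvgN; apply: cvgD; last exact: cVX.
  by apply: cvgM; [exact: cvg_cst|exact: cVX].
- by move=> y y0; rewrite invr_gt0 qroot_gt0.
- by move=> y y0; rewrite Finv invrK qrootK.
- move=> g g0; have u0 := Vgt0 _ g0; rewrite Ktilde_pdfE Finv quadraticK//
    disc_quadratic//.
  rewrite indic_pos_gt0 ?addr_gt0 ?mulr_gt0 ?exprn_gt0//
    /GIG_pdf indic_pos_gt0//.
  (* With [u = g^-1], the Jacobian [- F' g] is [u ^+ 2 * (1 + 2 * x * u)]. Its second factor cancels
     the discriminant, and [u ^+ 2] cancels the [g ^+ 2] split off here. *)
  have -> : g^-1 `^ (- lambda - 1) = g `^ (lambda - 1) * g ^+ 2.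
    rewrite -(powR_inv1 (ltW g0)) -powRrM (_ : -1 * _ = lambda - 1 + 2%:R).
      by rewrite powRD ?powR_mulrn ?(ltW g0)// (lt0r_neq0 g0) implybT.
    by ring.
  rewrite invrK (addrC g^-1) /F'; set c := (2 * _)^-1; set E := expR _.
  set W := _ `^ _.
  by field; rewrite lt0r_neq0//= lt0r_neq0// addr_gt0// mulr_gt0.
Qed.

End densities.

(** * The inverse-gamma law has mass one *)

Section inverse_gamma.
Context (R : realType).
Notation mu := (@lebesgue_measure R).
Implicit Types x y p : R.

Lemma powR_cvgy0 p : 0 < p -> x `^ (- p) @[x --> +oo] --> 0.
Proof.
move=> p0.
have V0 : x^-1 @[x --> +oo] --> (0 : R)^'+.
  move=> A [/= e e0 eA]; suff : \forall x \near +oo, A x^-1 by [].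
  near=> x.
  have x0 : 0 < x by near: x; exact: nbhs_pinfty_gt.
  apply: eA; rewrite /= ?invr_gt0// sub0r normrN gtr0_norm ?invr_gt0//.
  by rewrite invf_plt ?posrE//; near: x; apply: nbhs_pinfty_gt; exact: num_real.
have := cvg_comp _ _ V0 (powR_cvg0 p0); apply: cvg_trans.
apply: near_eq_cvg; near=> x => /=.
have x0 : 0 < x by near: x; exact: nbhs_pinfty_gt.
by rewrite -(powR_inv1 (ltW x0)) -powRrM mulN1r.
Unshelve. all: by end_near. Qed.

Lemma integral_powR_ray p : 0 < p ->
  (\int[mu]_(x in `[1%R, +oo[) (x `^ (- p - 1))%:E = (p^-1)%:E)%E.
Proof.
move=> p0; have p_neq0 := lt0r_neq0 p0.
pose F x := - p^-1 * x `^ (- p).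
have dF x : 0 < x -> is_derive x 1 F (x `^ (- p - 1)).
  move=> x0; have := is_derive1_powR (- p) x0;
    set G := (@powR R ^~ (- p)) => dG.
  rewrite (_ : F = (- p^-1) *: G)//.
  apply: is_derive_eq; rewrite /GRing.scale/= mulrA mulrNN.
  by rewrite mulVf// mul1r.
rewrite (@ge0_continuous_FTC2y _ _ F 1 0).
- by rewrite /F powR1 sub0e -EFinN mulr1 opprK.
- by move=> x _; exact: powR_ge0.
- apply: continuous_in_subspaceT => x; rewrite inE/= in_itv/= andbT => x1.
  by apply: powR_continuous; exact: lt_le_trans x1.
- rewrite -(mulr0 (- p^-1)); apply: cvgM; first exact: cvg_cst.
  exact: powR_cvgy0.
- by move=> x x1; have := dF _ (lt_trans ltr01 x1); case.
- apply: cvg_at_right_filter; apply: cvgM; first exact: cvg_cst.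
  exact: powR_continuous.
- move=> x; rewrite in_itv/= andbT => x1; have h := dF _ (lt_trans ltr01 x1).
  by rewrite derive1E derive_val.
Qed.

Variables (lambda s : R).
Hypotheses (lambda_gt0 : 0 < lambda) (s_gt0 : 0 < s).

(** The inverse-gamma weight before division by [Gamma lambda]; its integral is later shown to equal
    that constant. *)
Let f x := s `^ lambda * x `^ (- lambda - 1) * expR (- s / x) * \1_(`]0, +oo[)
  x.

Let f_ge0 x : 0 <= f x.
Proof. by rewrite !mulr_ge0// ?powR_ge0 ?expR_ge0. Qed.

Let f_le0 x : x <= 0 -> f x = 0.
Proof. by move=> x0; rewrite /f indic_pos_le0 ?mulr0. Qed.

Let measurable_f : measurable_fun setT f.
Proof.
apply: measurable_funM => //; apply: measurable_funM.
  by apply: measurable_funM => //; exact: measurable_powR.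
apply: measurableT_comp => //; apply: measurable_funM => //.
exact: measurable_inv.
Qed.

(* Near [0] the power [x ^ (- lambda - 1)] is absorbed by the exponential, as
   [(s / x) ^ n <= n`! * exp (s / x)]. *)
Let f_near0 : exists C, forall x, 0 < x -> x <= 1 -> f x <= C.
Proof.
pose n := (Num.truncn (lambda + 1)).+1.
exists (s `^ lambda * (n`!%:R / s ^+ n)) => x x0 x1.
rewrite /f indic_pos_gt0// mulr1 -mulrA ler_pM2l ?powR_gt0//.
rewrite mulNr expRN.
have sx0 : 0 <= s / x by rewrite divr_ge0// ltW.
have := expR_ge1Dxn n.-1 sx0; rewrite prednK// => en.
have xn : x `^ (- lambda - 1) <= x ^- n.
  rewrite -powR_invn; last exact: ltW.
  apply: ger_powR; rewrite ?x0//.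
  by rewrite -opprD lerN2 ltW// truncnS_gt.
rewrite ler_pdivrMr ?expR_gt0//; apply: (le_trans xn).
have fn0 : 0 < n`!%:R :> R by rewrite ltr0n fact_gt0.
have {}en : (s / x) ^+ n / n`!%:R <= expR (s / x).
  by apply: le_trans en; rewrite lerDr.
have := en; rewrite ler_pdivrMr// expr_div_n.
rewrite -(ler_pM2l (_ : 0 < (s ^+ n)^-1)) ?invr_gt0 ?exprn_gt0//.
rewrite mulrA mulVf ?mul1r ?expf_neq0 ?lt0r_neq0// => h.
by rewrite (le_trans h)// le_eqVlt; apply/orP; left; apply/eqP; ring.
Qed.

Let f_nearoo x : 1 <= x -> f x <= s `^ lambda * x `^ (- lambda - 1).
Proof.
move=> x1; have x0 : 0 < x by exact: lt_le_trans x1.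
rewrite /f indic_pos_gt0// mulr1 ler_piMr ?mulr_ge0 ?powR_ge0//.
by rewrite -expR0 ler_expR mulNr oppr_le0 divr_ge0// ltW.
Qed.

Let integral_f_fin : (\int[mu]_x (f x)%:E < +oo)%E.
Proof.
have [C fC] := f_near0.
have C0 : 0 <= C by apply: le_trans (fC 1 _ _).
have mpow : measurable_fun setT (fun x => (x `^ (- lambda - 1))).
  exact: measurable_powR.
(* Integrable majorants on the two sides of 1: a constant near 0 and a power near infinity. *)
pose h1 x : \bar R := (C%:E * (\1_(`]0, 1]) x)%:E)%E.
pose h2 x : \bar R := ((s `^ lambda)%:E *
  (x `^ (- lambda - 1) * \1_(`[1%R, +oo[) x)%:E)%E.
have mh1 : measurable_fun setT h1 by apply/measurable_EFinP;
  exact: measurable_funM.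
have mh2 : measurable_fun setT h2.
  by apply/measurable_EFinP; apply: measurable_funM => //;
    exact: measurable_funM.
have h1_0 x : (0 <= h1 x)%E by rewrite lee_fin mulr_ge0.
have h2_0 x : (0 <= h2 x)%E by rewrite lee_fin !mulr_ge0 ?powR_ge0.
apply: (@le_lt_trans _ _ (\int[mu]_x (h1 x + h2 x))%E).
  apply: ge0_le_integral => //.
  - by move=> x _; rewrite lee_fin.
  - exact/measurable_EFinP.
  - exact: emeasurable_funD.
  move=> x _; rewrite /h1 /h2 -!EFinM -EFinD lee_fin.
  have [x0|x0] := leP x 0.
    by rewrite f_le0// addr_ge0// !mulr_ge0// powR_ge0.
  have [x1|/ltW x1] := leP x 1.
    rewrite [\1_(`]0, 1]) x]indicE mem_set/=; last by rewrite in_itv/= x0.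
    by rewrite mulr1 ler_wpDr ?fC// !mulr_ge0// powR_ge0.
  rewrite [\1_(`[1%R, +oo[) x]indicE mem_set/=; last by rewrite in_itv/= x1.
  by rewrite mulr1 ler_wpDl ?f_nearoo// mulr_ge0.
rewrite ge0_integralD// /h1 /h2.
rewrite !ge0_integralZl//; last 4 first.
- by apply/measurable_EFinP; exact: measurable_funM.
- by move=> x _; rewrite lee_fin mulr_ge0// powR_ge0.
- by rewrite lee_fin powR_ge0.
- by apply/measurable_EFinP.
rewrite integral_indic//= setIT lebesgue_measure_itv/= lte_fin ltr01.
rewrite (_ : (\int[mu]_x _)%E = (lambda^-1)%:E).
  by rewrite -EFinB -!EFinM -EFinD ltry.
rewrite -integral_powR_ray// [RHS]integral_mkcond; apply: eq_integral => x _.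
by rewrite patchE indicE; case: ifPn => _; rewrite ?mulr1 ?mulr0.
Qed.

Let integral_f_gt0 : (0 < \int[mu]_x (f x)%:E)%E.
Proof.
(* A lower bound of [f] on [[1, 2]]: there the power is smallest at 2 and the exponential at 1. *)
pose c := s `^ lambda * 2 `^ (- lambda - 1) * expR (- s).
have c0 : 0 < c by rewrite !mulr_gt0 ?powR_gt0 ?expR_gt0.
apply: (@lt_le_trans _ _ (\int[mu]_x (c * \1_(`[1, 2]) x)%:E)%E).
  under eq_integral do rewrite EFinM.
  rewrite ge0_integralZl//; last 2 first.
  - exact/measurable_EFinP.
  - by rewrite lee_fin ltW.
  rewrite integral_indic//= setIT lebesgue_measure_itv/= lte_fin ltr1n/=.
  by rewrite -EFinB -EFinM lte_fin mulr_gt0// subr_gt0 ltr1n.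
apply: ge0_le_integral => //.
- by move=> x _; rewrite lee_fin mulr_ge0// ltW.
- by apply/measurable_EFinP; exact: measurable_funM.
- exact/measurable_EFinP.
move=> x _; rewrite lee_fin indicE; case: (boolP (_ \in _)) => [|_];
  last by rewrite mulr0.
rewrite inE/= in_itv/= mulr1 => /andP[x1 x2].
have x0 : 0 < x by exact: lt_le_trans x1.
rewrite /f indic_pos_gt0// mulr1 /c; apply: ler_pM;
  rewrite ?mulr_ge0 ?powR_ge0 ?expR_ge0//.
  rewrite ler_pM2l ?powR_gt0// -opprD !powRN lef_pV2 ?posrE ?powR_gt0//.
  by apply: ge0_ler_powR; rewrite ?nnegrE ?addr_ge0// ltW.
by rewrite ler_expR mulNr lerN2 ler_pdivrMr// ler_peMr// ltW.
Qed.

Let J := fine (\int[mu]_x (f x)%:E).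

Let JE : (\int[mu]_x (f x)%:E)%E = J%:E.
Proof. by rewrite fineK// ge0_fin_numE// ltW. Qed.

Let J_gt0 : 0 < J.
Proof. by rewrite -lte_fin -JE. Qed.

Let integral_fJ : (\int[mu]_x (J^-1 * f x)%:E = 1)%E.
Proof.
under eq_integral do rewrite EFinM.
rewrite ge0_integralZl//; last 3 first.
- exact/measurable_EFinP.
- by move=> x _; rewrite lee_fin.
- by rewrite lee_fin invr_ge0 ltW.
by rewrite JE -EFinM mulVf// lt0r_neq0.
Qed.

(** The probability with density [J^-1 * f] is pushed forward by [x |-> s / x]. The image has
    density [J^-1 * g], with [g] the integrand of [Gamma], and comparing total masses gives the
    integral of [g]. Normalising by [J] first supplies the finite measure that the change of
    variables takes. *)
Let GammaJ : Gamma lambda = J.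
Proof.
pose g t := t `^ (lambda - 1) * expR (- t) * \1_(`]0, +oo[) t.
have g0 t : 0 <= g t by rewrite !mulr_ge0 ?powR_ge0 ?expR_ge0.
have mg : measurable_fun setT g.
  apply: measurable_funM => //; apply: measurable_funM;
    first exact: measurable_powR.
  by apply: measurableT_comp => //; exact: measurable_funN.
have fJ0 x : 0 <= J^-1 * f x by rewrite mulr_ge0// invr_ge0 ltW.
have mfJ : measurable_fun setT (fun x => J^-1 * f x) by exact: measurable_funM.
have [m mE] := exists_probability_has_density fJ0 mfJ integral_fJ.
pose F (x : R) := s / x.
pose F' (x : R) := - (s * x ^- 2).
have mF : measurable_fun setT F.
  by apply: measurable_funM => //; exact: measurable_inv.
have F0 x : 0 < x -> 0 < F x by move=> x0; rewrite divr_gt0.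
have gE : has_density (pushforward m F) (fun t => J^-1 * g t).
  apply: (@pushforward_decreasing_density R (fun x => J^-1 * f x) _ F F' F) =>
    //.
  - by move=> x x0; rewrite f_le0// mulr0.
  - by move=> t; rewrite mulr_ge0// invr_ge0 ltW.
  - exact: measurable_funM.
  - by move=> t t0; rewrite /g indic_pos_le0// !mulr0.
  - move=> t t0; pose k (t : R) := J^-1 * (t `^ (lambda - 1) * expR (- t)).
    have kE z : 0 < z -> k z = J^-1 * g z.
      by move=> z0; rewrite /k /g indic_pos_gt0// mulr1.
    suff ck : k z @[z --> t] --> k t.
      rewrite /prop_for /continuous_at -kE//; apply: cvg_trans ck.
      by apply: near_eq_cvg; near=> z; rewrite kE//; near: z; exact: lt_nbhsr.
    apply: cvgM; first exact: cvg_cst.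
    apply: cvgM; first exact: powR_continuous.
    by apply: continuous_cvg; [exact: continuous_expR|apply: cvgN;
      exact: cvg_id].
  - by move=> x y x0 xy; rewrite ltr_pM2l// ltf_pV2// posrE (lt_trans x0).
  - move=> x x0; have := is_derive_inv (lt0r_neq0 x0);
      set V := (fun _ => _^-1) => dV.
    rewrite (_ : F = s *: V)//.
    by apply: is_derive_eq; rewrite /F' /GRing.scale/= mulrN.
  - move=> x x0; apply: cvgN; apply: cvgM; first exact: cvg_cst.
    apply: cvgV; first by rewrite expf_neq0// lt0r_neq0.
    exact: exprn_continuous.
  - by move=> y y0; rewrite /F invf_div mulrCA divff ?mulr1// lt0r_neq0.
  - move=> x x0; rewrite /g indic_pos_gt0 ?F0// /f indic_pos_gt0// /F /F'.
    rewrite powRM ?invr_ge0 ?ltW// -(powR_inv1 (ltW x0)) -powRrM.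
    (* The factor [x ^+ 2] cancels against the Jacobian [s * x ^- 2], whose [s] raises the power of
       [s] to [lambda]. *)
    have -> : x `^ (-1 * (lambda - 1)) = x `^ (- lambda - 1) * x ^+ 2.
      rewrite (_ : -1 * _ = - lambda - 1 + 2%:R); last by ring.
      by rewrite powRD ?powR_mulrn ?(ltW x0)// (lt0r_neq0 x0) implybT.
    have -> : s `^ lambda = s `^ (lambda - 1) * s.
      by rewrite mulrC mulr_powRB1// ltW.
    rewrite powR_inv1 ?ltW// mulNr; set E := expR _; set W := x `^ _.
    set W' := s `^ _.
    by field; rewrite !lt0r_neq0.
have : (\int[mu]_t (J^-1 * g t)%:E = 1)%E.
  by rewrite -(gE setT)// -[RHS](probability_setT m).
under eq_integral do rewrite EFinM.
rewrite ge0_integralZl//; last 3 first.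
- exact/measurable_EFinP.
- by move=> t _; rewrite lee_fin.
- by rewrite lee_fin invr_ge0 ltW.
move=> gJ; rewrite /Gamma /Rintegral -[RHS]/(fine J%:E); congr fine.
have -> : (\int[mu]_(t in `]0%R, +oo[) (t `^ (lambda - 1) * expR (- t))%:E =
    \int[mu]_t (g t)%:E)%E.
  rewrite integral_mkcond; apply: eq_integral => t _.
  by rewrite patchE /g indicE; case: ifPn => _; rewrite ?mulr1 ?mulr0.
have := congr1 (mule J%:E) gJ.
by rewrite muleA -EFinM divff ?lt0r_neq0// mul1e mule1.
Unshelve. all: by end_near. Qed.

Lemma integral_inverse_gamma_pdf :
  (\int[mu]_x (inverse_gamma_pdf lambda s x)%:E = 1)%E.
Proof.
rewrite -[RHS]integral_fJ; apply: eq_integral => x _; congr EFin.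
by rewrite /inverse_gamma_pdf GammaJ /f; ring.
Qed.

Lemma measurable_inverse_gamma_pdf : measurable_fun setT (inverse_gamma_pdf
  lambda s).
Proof.
rewrite (_ : inverse_gamma_pdf _ _ = fun x => J^-1 * f x).
  exact: measurable_funM.
by apply/funext => x; rewrite /inverse_gamma_pdf GammaJ /f; ring.
Qed.

Lemma inverse_gamma_pdf_ge0 x : 0 <= inverse_gamma_pdf lambda s x.
Proof.
rewrite !mulr_ge0 ?powR_ge0 ?expR_ge0// GammaJ.
by rewrite invr_ge0 ltW.
Qed.

End inverse_gamma.

(** * From detailed balance of densities to reversibility and invariance *)

Section reversibility.
Context (R : realType).
Notation mu := (@lebesgue_measure R).
Variables (pi : probability R R) (K : R.-pker R ~> R).
Variables (p : R -> R) (k : R -> R -> R).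
Hypotheses (p0 : forall x, 0 <= p x) (mp : measurable_fun setT p)
  (pN : forall x : R, x <= 0 -> p x = 0) (piE : has_density pi p).
Hypotheses (k0 : forall x y, 0 <= k x y)
  (mk : measurable_fun setT (fun z : R * R => k z.1 z.2))
  (KE : forall x : R, 0 < x -> has_density (K x) (k x)).
Hypothesis balance : forall x y, p x * k x y = p y * k y x.

Let w (C : set (R * R)) (z : R * R) : \bar R :=
  (p z.1 * k z.1 z.2 * \1_C z)%:E.

Let integral_kernelE (C : set (R * R)) : measurable C ->
  (\int[pi]_x K x (xsection C x) = \int[mu]_x \int[mu]_y w C (x, y))%E.
Proof.
move=> mC; rewrite (ge0_integral_has_density p0 mp piE)//; last first.
  by apply: (measurable_fun_xsection_finite_kernel K); rewrite inE.
(* At [x <= 0] the kernel has no known density, but there [p x = 0] makes both sides vanish. *)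
apply: eq_integral => x _; have [x0|x0] := leP x 0.
  rewrite pN// mule0 integral0_eq// => y _.
  by rewrite /w/= pN// !mul0r.
have mCx : measurable (xsection C x) by exact: measurable_xsection.
rewrite KE// muleC integral_mkcond.
rewrite -ge0_integralZl//.
- apply: eq_integral => y _; rewrite /w/= patchE indicE.
  rewrite (_ : (y \in xsection C x) = ((x, y) \in C)); last first.
    by rewrite mem_xsection.
  by case: ifPn => _; rewrite ?mulr1 ?mulr0 ?mule0 ?EFinM.
- apply/(measurable_restrictT _ _).1 => //; apply/measurable_EFinP.
  by apply: measurable_funTS; exact: measurable_fun_pair2 mk.
- by move=> y _; rewrite patchE; case: ifPn => // _; rewrite lee_fin.
- by rewrite lee_fin.
Qed.

(** Swapping coordinates turns [ysection] into [xsection], so both sides become iterated integrals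
    of joint densities; Tonelli exchanges the order and [balance] matches the integrands. *)
Lemma detailed_balance_reversible : reversible_wrt pi K.
Proof.
move=> C mC; pose C' := [set z : R * R | C (z.2, z.1)].
have mswap : measurable_fun setT (fun z : R * R => (z.2, z.1)).
  exact: measurable_fun_pair.
have mC' : measurable C'.
  by rewrite -[X in measurable X]setTI; exact: mswap.
transitivity (\int[pi]_y K y (xsection C' y))%E; last first.
  by apply: eq_integral => y _; rewrite (_ : xsection C' y = ysection C y).
apply: etrans (integral_kernelE mC) _.
apply: etrans _ (esym (integral_kernelE mC')).
have mw : measurable_fun setT (w C).
  apply/measurable_EFinP; apply: measurable_funM => //.
  by apply: measurable_funM => //; exact: measurableT_comp.
have w0 z : (0 <= w C z)%E by rewrite lee_fin !mulr_ge0.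
apply: etrans (fubini_tonelli (m1 := mu) (m2 := mu) (w C) mw w0) _.
apply: eq_integral => y _; apply: eq_integral => x _.
by rewrite /w/= balance !indicE; congr ((_ * (_ : bool)%:R)%:E);
  apply/idP/idP; rewrite !inE.
Qed.

End reversibility.

(** Reversibility is tested on the strip of all points with second coordinate in [B]; on the right
    the kernel then contributes its full mass 1 when [y] is in [B], and 0 otherwise. *)
Lemma reversible_invariant (R : realType) (pi : probability R R)
  (K : R.-pker R ~> R) : reversible_wrt pi K -> invariant_measure pi K.
Proof.
move=> rev B mB; have mC : measurable ([set: R] `*` B) by exact: measurableX.
transitivity (\int[pi]_x K x (xsection ([set: R] `*` B) x))%E.
  by apply: eq_integral => x _; rewrite in_xsectionX// inE.
rewrite rev// -(setIT B) -integral_indic//; apply: eq_integral => y _.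
rewrite setIT indicE; have [yB|yB] := boolP (y \in B).
  by rewrite in_ysectionX// prob_kernel.
by rewrite notin_ysectionX// measure0.
Qed.

Section detailed_balance.
Context (R : realType) (lambda a : R).
Implicit Types x y : R.

Lemma pi_pdfE x : 0 < a ->
  pi_pdf lambda a x = inverse_gamma_pdf lambda (a ^+ 2 / 2) x.
Proof.
move=> a0; rewrite /pi_pdf /inverse_gamma_pdf.
have -> : (a ^+ 2 / 2) `^ lambda = a `^ (2 * lambda) / 2 `^ lambda.
  rewrite powRM ?exprn_ge0 ?invr_ge0 ?ltW// -powR_mulrn ?ltW// -powRrM.
  by rewrite -(powR_inv1 (ltW _))// -powRrM mulN1r powRN.
by rewrite !invfM !mulNr !mulrA.
Qed.

Lemma inverse_gamma_pdf_le0 s x : x <= 0 -> inverse_gamma_pdf lambda s x = 0.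
Proof. by move=> x0; rewrite /inverse_gamma_pdf indic_pos_le0// mulr0. Qed.

Lemma inverse_gamma_detailed_balance x y :
  inverse_gamma_pdf lambda (a ^+ 2 / 2) x * Ktilde_pdf lambda a x y =
  inverse_gamma_pdf lambda (a ^+ 2 / 2) y * Ktilde_pdf lambda a y x.
Proof.
have [x0|x0] := leP x 0.
  by rewrite (inverse_gamma_pdf_le0 _ x0) (@Ktilde_pdf_le0 _ _ _ y x)//
    mul0r mulr0.
have [y0|y0] := leP y 0.
  by rewrite (inverse_gamma_pdf_le0 _ y0) (@Ktilde_pdf_le0 _ _ _ x y)//
    mul0r mulr0.
pose s := a ^+ 2 / 2; pose D := disc x y.
(* The right-hand side is symmetric in [u] and [v], up to the order of the last two summands. The
   power of [u] from the weight merges with that of the root into a power of [u * qroot u v]. *)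
suff main u v : 0 < u -> 0 < v ->
    inverse_gamma_pdf lambda s u * Ktilde_pdf lambda a u v =
    s `^ lambda / Gamma lambda * (2 * Macdonald lambda (a ^+ 2))^-1 *
    (disc u v)^-1 * ((disc u v - 1) / 2) `^ (- lambda - 1) *
    expR (- s * ((disc u v + 1) / (2 * u) + (disc u v + 1) / (2 * v))).
  rewrite !main// (discC y x); congr (_ * expR (_ * _)); exact: addrC.
move=> u0 v0; rewrite /inverse_gamma_pdf Ktilde_pdfE !indic_pos_gt0// -/s.
rewrite -(mul_qroot v u0) powRM ?ltW ?qroot_gt0//.
have -> : expR (- s * ((disc u v + 1) / (2 * u) + (disc u v + 1) / (2 * v))) =
    expR (- s / u) * expR (- s * (qroot u v + (qroot u v)^-1)).
  rewrite -expRD qroot_inv// /qroot; congr expR.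
  by field; rewrite !lt0r_neq0.
set U := u `^ _; set Q := qroot u v `^ _; set E := expR _; set E' := expR _.
by ring.
Qed.

End detailed_balance.

Theorem proposition5p6 (R : realType) (d : measure_display)
    (T : measurableType d) (P : probability T R)
    (a lambda : R) (gamma : nat -> {RV P >-> R}) (a_gt0 : 0 < a)
    (gamma_indep : mutually_independent gamma)
    (gamma_law : forall i,
       has_density (distribution P (gamma i)) (GIG_pdf lambda a)) :
  exists K : R.-pker R ~> R,
    [/\ forall x, 0 < x -> has_density (K x) (Ktilde_pdf lambda a x),
        homogeneous_markov_chain P `]0, +oo[
          (fun m => Ntilde gamma m.+1) K,
        forall w, Ntilde gamma 1 w = (gamma 0%N w)^-1 &
        0 < lambda ->
        exists pi : probability R R,
          [/\ has_density pi (pi_pdf lambda a),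
              has_density pi (inverse_gamma_pdf lambda (a ^+ 2 / 2)),
              reversible_wrt pi K &
              invariant_measure pi K]].
Proof.
pose nu : probability R R := distribution P (gamma 0%N).
have nuE : has_density nu (GIG_pdf lambda a) by exact: gamma_law.
have law i B : measurable B -> P (gamma i @^-1` B) = nu B.
  by move=> mB; rewrite nuE// -(gamma_law i).
have nu_pos : nu `]0, +oo[%classic = 1%E.
  (* [nu] is a probability and its density vanishes off the half-line, so the complement has mass
     0. *)
  rewrite -(setCK `]0, +oo[%classic) probability_setC; last exact: measurableC.
  rewrite nuE; last exact: measurableC.
  rewrite integral0_eq ?sube0// => x /=.
  by rewrite in_itv/= andbT => /negP; rewrite -leNgt => x0; rewrite GIG_pdf_le0.
have KE (x : R) : 0 < x -> has_density (Ktilde nu x) (Ktilde_pdf lambda a x).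
  by move=> x0; exact: Ktilde_has_density.
exists (Ktilde nu); split => //.
- exact: Ntilde_markov.
- by move=> w; rewrite NtildeS Ntilde0 mul0r add0r.
move=> lambda_gt0; have s_gt0 : 0 < a ^+ 2 / 2 by rewrite divr_gt0// exprn_gt0.
have p0 := inverse_gamma_pdf_ge0 lambda_gt0 s_gt0.
have mp := measurable_inverse_gamma_pdf lambda_gt0 s_gt0.
have [pi piE] := exists_probability_has_density p0 mp
  (integral_inverse_gamma_pdf lambda_gt0 s_gt0).
exists pi.
have rev : reversible_wrt pi (Ktilde nu).
  apply: (detailed_balance_reversible p0 mp _ piE _ _ KE) => //.
  - exact: inverse_gamma_pdf_le0.
  - exact: Ktilde_pdf_ge0.
  - exact: measurable_Ktilde_pdf.
  - exact: inverse_gamma_detailed_balance.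
split => //; last exact: reversible_invariant.
by move=> B mB; rewrite piE//; apply: eq_integral => x _; rewrite pi_pdfE.
Qed.
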